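(* Let $n\geq 2$ and let $D_{2n}=\langle x,y\mid x^n=y^2=1,\ yxy=x^{-1}\rangle$ be the dihedral group of order $2n$. Then the number $c_3(D_{2n})$ of distinct coverings of $D_{2n}$ with three proper subgroups is $$c_3(D_{2n})=\begin{cases}0,&\text{if } n \text{ is odd},\\ 1,&\text{if } n \text{ is even}.\end{cases}$$
   Context: A subgroup $H$ of a group $G$ is proper if $H\neq G$. A covering of a finite group $G$ with three proper subgroups is an (unordered) set $\{H_1,H_2,H_3\}$ of three proper subgroups of $G$ with $G=H_1\cup H_2\cup H_3$, and $c_3(G)$ denotes the number of such sets. *)

(* Defs.v *)
From mathcomp Require Import all_boot all_fingroup all_solvable.

Set Implicit Arguments.
Unset Strict Implicit.
Unset Printing Implicit Defensive.

Local Open Scope group_scope.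

(* A covering is an unordered set {H1, H2, H3}, encoded as a set of cardinal  *)
(* 3; so the three subgroups are pairwise distinct.                           *)
Definition covering3 (gT : finGroupType) (G : {group gT})
    (S : {set {group gT}}) : bool :=
  [&& #|S| == 3, [forall H in S, H \proper G] & \bigcup_(H in S) H == G].

Definition num_coverings3 (gT : finGroupType) (G : {group gT}) : nat :=
  #|[set S : {set {group gT}} | covering3 G S]|.

(* G \isog Grp (...) says that G is the largest finite quotient of the        *)
(* presented group; as the dihedral presentation defines a finite group, G is *)
(* the presented group itself.                                                *)
Definition is_dihedral (gT : finGroupType) (n : nat) (G : {group gT}) : Prop :=
  G \isog Grp (x : y : x ^+ n, y ^+ 2, y * x * y = x^-1).

(* The library's 'D_(2n) is such a group. *)
Lemma is_dihedral_D (n : nat) : 1 < n -> is_dihedral n 'D_(2 * n).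
Proof.
move=> n_gt1 rT H; rewrite mul2n (Grp_dihedral n_gt1).
have relE (x y : rT) : y ^+ 2 = 1 -> (x ^ y == x^-1) = (y * x * y == x^-1).
  move=> y2; have yV : y^-1 = y by apply/eqP; rewrite eq_invg_mul -expg2 y2.
  by rewrite conjgE yV mulgA.
apply: eq_existsb => -[x y] /=; rewrite !xpair_eqE.
by case: (y ^+ 2 =P 1) => [y2|_]; rewrite ?andbF //= relE.
Qed.

Lemma card_is_dihedral (gT : finGroupType) (n : nat) (G : {group gT}) :
  1 < n -> is_dihedral n G -> #|G| = (2 * n)%N.
Proof.
move=> n_gt1 dG; have dD := is_dihedral_D n_gt1.
have isoGD : G \isog 'D_(2 * n).
  rewrite isogEhom; apply/andP; split.
    by rewrite dD; apply: isoGrp_hom dG.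
  by rewrite dG; apply: isoGrp_hom dD.
by rewrite (card_isog isoGD) mul2n (card_dihedral n_gt1).
Qed.

(* Main.v *)
Require Import Defs.
From mathcomp Require Import all_boot all_fingroup all_solvable.
From mathcomp Require Import zmodp.

(** Three proper subgroups that cover [G] have index 2 (Scorza).  An index 2
    subgroup is the kernel of a character with values in [{1, -1}], so it is
    determined by which of the two generators [x] and [y] it contains, and it
    does not contain both: there are at most three of them, hence at most one
    covering.  If [n] is odd then [x = (x ^+ n.+1./2) ^+ 2] lies in each of them,
    which leaves at most one subgroup.  If [n] is even, then [G] maps onto
    [Z/2 x Z/2], and the preimages of the three subgroups of order 2 cover [G]. *)

Set Implicit Arguments.
Unset Strict Implicit.
Unset Printing Implicit Defensive.

(** * Subgroups of index 2 and coverings by three proper subgroups *)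

Section IndexTwo.

Import GroupScope.

Variable gT : finGroupType.
Implicit Types A B C G H K : {group gT}.

(* For a proper subgroup, this says that [H] has index 2 in [G]. *)
Definition sign_closed G H :=
  [forall g in G, forall h in G, (g * h \in H) == ((g \in H) == (h \in H))].

Lemma sign_closedP G H :
  reflect {in G &, forall g h, (g * h \in H) = ((g \in H) == (h \in H))}
          (sign_closed G H).
Proof.
apply: (iffP forall_inP) => [sH g h gG hG | sH g gG].
  by have /forall_inP/(_ h hG)/eqP := sH g gG.
by apply/forall_inP=> h hG; rewrite sH.
Qed.

Definition sign_kernels G : {set {group gT}} :=
  [set H : {group gT} | (H \proper G) && sign_closed G H].

(** If [b] is in [B] but not in [A], and [a] is in [A] but not in [B], then [a * b] is in
    neither. *)
Lemma proper2_avoid G A B : A \proper G -> B \proper G ->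
  exists2 w, w \in G & (w \notin A) && (w \notin B).
Proof.
case/properP=> sAG [b bG bNA] /properP[sBG [a aG aNB]].
have [bB|bNB] := boolP (b \in B); last by exists b => //; rewrite bNA.
have [aA|aNA] := boolP (a \in A); last by exists a => //; rewrite aNA.
exists (a * b); first exact: groupM.
by rewrite [_ \in A]groupMl // bNA [_ \in B]groupMr.
Qed.

(** Multiplying an element [w] outside [A] and [B] by [z] in [A :&: B] keeps it outside both, so [w]
    and [z * w] lie in [C], and hence so does [z]. *)
Lemma cover3_setI_sub G A B C : A \proper G -> B \proper G ->
  {in G, forall g, [|| g \in A, g \in B | g \in C]} -> A :&: B \subset C.
Proof.
move=> pA pB cov; apply/subsetP=> z /setIP[zA zB].
have [w wG /andP[wNA wNB]] := proper2_avoid pA pB.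
have zG : z \in G by apply: (subsetP (proper_sub pA)).
have wC : w \in C by move: (cov w wG); rewrite (negbTE wNA) (negbTE wNB).
have := cov (z * w) (groupM zG wG).
by rewrite groupMl // (negbTE wNA) groupMl // (negbTE wNB) groupMr.
Qed.

(** Only [g] and [h] both outside [A] need work. Since [B :&: C] lies in [A], each is in exactly one
    of [B] and [C]. If they are on opposite sides, [g * h] avoids [B] and [C], so it falls in
    [A]. *)
Lemma cover3_sign_closed G A B C :
    A \proper G -> B \proper G -> C \proper G ->
  {in G, forall g, [|| g \in A, g \in B | g \in C]} -> sign_closed G A.
Proof.
move=> pA pB pC cov.
have covBC : {in G, forall g, [|| g \in B, g \in C | g \in A]}.
  by move=> g gG; rewrite orbA orbC cov.
have sBC_A := subsetP (cover3_setI_sub pB pC covBC).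
have [a aG /andP[aNB aNC]] := proper2_avoid pB pC.
have aA : a \in A by move: (cov a aG); rewrite (negbTE aNB) (negbTE aNC) !orbF.
apply/sign_closedP=> g h gG hG.
have [gA|gNA] := boolP (g \in A); first by rewrite groupMl.
have [hA|hNA] := boolP (h \in A); first by rewrite groupMr // (negbTE gNA).
have notBC k : k \notin A -> ~~ ((k \in B) && (k \in C)).
  by apply: contra => kBC; apply: sBC_A; rewrite inE.
have covN k : k \in G -> k \notin A -> (k \in B) || (k \in C).
  by move=> kG /negbTE kNA; have := cov k kG; rewrite kNA.
(* If [g] and [h] both lie in [B], or both in [C], then [h * a] lies in the
   other one, and the case of opposite sides applies to [g] and [h * a]. *)
have [gB|gNB] := boolP (g \in B); last first.
  have gC : g \in C by move: (covN g gG gNA); rewrite (negbTE gNB).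
  have [hB|hNB] := boolP (h \in B).
    have hNC : h \notin C by move: (notBC h hNA); rewrite hB.
    have := cov (g * h) (groupM gG hG).
    by rewrite [_ \in B]groupMr // (negbTE gNB) [_ \in C]groupMl //
               (negbTE hNC) !orbF.
  have hC : h \in C by move: (covN h hG hNA); rewrite (negbTE hNB).
  have haB : h * a \in B.
    have := cov (h * a) (groupM hG aG).
    by rewrite [_ \in A]groupMr // (negbTE hNA) [_ \in C]groupMl //
               (negbTE aNC) orbF.
  have := cov (g * (h * a)) (groupM gG (groupM hG aG)).
  rewrite [_ \in B]groupMr // (negbTE gNB) [_ \in C]groupMl //.
  by rewrite [_ \in C]groupMl // (negbTE aNC) !orbF mulgA groupMr.
have gNC : g \notin C by move: (notBC g gNA); rewrite gB.
have [hC|hNC] := boolP (h \in C).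
  have hNB : h \notin B by move: (notBC h hNA); rewrite hC andbT.
  have := cov (g * h) (groupM gG hG).
  by rewrite [_ \in C]groupMr // (negbTE gNC) [_ \in B]groupMl //
             (negbTE hNB) !orbF.
have hB : h \in B by move: (covN h hG hNA); rewrite (negbTE hNC) orbF.
have haC : h * a \in C.
  have := cov (h * a) (groupM hG aG).
  by rewrite [_ \in A]groupMr // (negbTE hNA) [_ \in B]groupMl // (negbTE aNB).
have := cov (g * (h * a)) (groupM gG (groupM hG aG)).
rewrite [_ \in C]groupMr // (negbTE gNC) [_ \in B]groupMl //.
by rewrite [_ \in B]groupMl // (negbTE aNB) !orbF mulgA groupMr.
Qed.

Lemma covering3_sub_sign_kernels G (S : {set {group gT}}) :
  covering3 G S -> S \subset sign_kernels G.
Proof.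
case/and3P=> /eqP cS /forall_inP pS /eqP defG.
apply/subsetP=> A AS; rewrite inE pS //=.
have /cards2P[B [C [_ defS]]] : #|S :\ A| == 2.
  by move: cS; rewrite (cardsD1 A) AS add1n => -[->].
have [BS CS] : B \in S /\ C \in S.
  have sS : S :\ A \subset S by apply: subD1set.
  by split; apply: (subsetP sS); rewrite defS !inE eqxx ?orbT.
apply: (@cover3_sign_closed G A B C); rewrite ?pS // => g.
rewrite -defG => /bigcupP[H HS gH].
have [<-|neqHA] := eqVneq H A; first by rewrite gH.
have: H \in S :\ A by rewrite !inE neqHA.
by rewrite defS !inE => /orP[]/eqP <-; rewrite gH ?orbT.
Qed.

Section TwoGenerators.

Variables (G : {group gT}) (x y : gT).
Hypothesis defG : <[x]> <*> <[y]> = G.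

Let sub_xy (K : {group gT}) : x \in K -> y \in K -> G \subset K.
Proof. by move=> xK yK; rewrite -defG join_subG !cycle_subG xK. Qed.

Let xG : x \in G.
Proof. by rewrite -defG (subsetP (joing_subl _ _)) ?cycle_id. Qed.

Let yG : y \in G.
Proof. by rewrite -defG (subsetP (joing_subr _ _)) ?cycle_id. Qed.

Lemma sign_kernel_gen_neq (H : {group gT}) :
  H \in sign_kernels G -> (x \in H, y \in H) != (true, true).
Proof.
rewrite inE => /andP[/proper_subn nsGH _].
by apply: contra nsGH => /eqP[xH yH]; apply: sub_xy.
Qed.

(** The elements of [G] on which membership in [H] and in [K] agree form a subgroup, by the sign
    rule; it is all of [G] once it contains [x] and [y]. *)
Lemma sign_kernel_gen_inj :
  {in sign_kernels G &,
    injective (fun H : {group gT} => (x \in H, y \in H))}.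
Proof.
move=> H K; rewrite !inE => /andP[pH /sign_closedP sH] /andP[pK /sign_closedP sK].
move=> [eqx eqy].
have gA : group_set [set g in G | (g \in H) == (g \in K)].
  apply/group_setP; split=> [|g h]; rewrite !inE ?group1 //.
  move=> /andP[gG /eqP eg] /andP[hG /eqP eh].
  by rewrite groupM //= sH // sK // eg eh.
have sGA : G \subset Group gA.
  by apply: sub_xy; rewrite inE ?xG ?yG ?eqx ?eqy eqxx.
apply/val_inj/setP=> g /=; have [gG|gNG] := boolP (g \in G).
  by have := subsetP sGA g gG; rewrite inE gG => /eqP.
rewrite (contraNF (subsetP (proper_sub pH) g)) //.
by rewrite (contraNF (subsetP (proper_sub pK) g)).
Qed.

Lemma card_sign_kernels : #|sign_kernels G| <= 3.
Proof.
rewrite -(card_in_imset sign_kernel_gen_inj).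
have -> : 3 = #|[set~ (true, true)]|.
  by rewrite cardsC1 card_prod card_bool.
apply/subset_leq_card/subsetP=> _ /imsetP[H HI ->].
by rewrite in_setC1 sign_kernel_gen_neq.
Qed.

Lemma card_sign_kernels_odd n :
  odd n -> x ^+ n = 1 -> #|sign_kernels G| <= 1.
Proof.
move=> n_odd xn; rewrite -(card_in_imset sign_kernel_gen_inj) -(cards1 (true, false)).
apply/subset_leq_card/subsetP=> _ /imsetP[H HI ->].
have xH : x \in H.
  have /sign_closedP sH : sign_closed G H by move: HI; rewrite inE => /andP[].
  (* The sign rule puts every square in [H]; the exponents add up to [n.+1] because [n] is odd. *)
  have -> : x = x ^+ n.+1./2 * x ^+ n.+1./2.
    by rewrite -expgD addnn halfK /= n_odd subn0 expgS xn mulg1.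
  by rewrite sH ?eqxx // groupX.
have := sign_kernel_gen_neq HI.
by rewrite in_set1 xH !xpair_eqE; case: (y \in H).
Qed.

End TwoGenerators.

End IndexTwo.

(** * Coverings pulled back from the Klein four-group *)

Section KleinPreimage.

Import GroupScope.

Variables (gT rT : finGroupType) (G : {group gT}) (V : {group rT}).
Variable f : {morphism G >-> rT}.
Hypotheses (imf : f @* G = V) (V4 : #|V| = 4) (V_exp2 : exponent V %| 2).

Lemma covering3_klein_morphim :
  covering3 G [set (f @*^-1 <[v]>)%G | v in V^#].
Proof.
have order2 v : v \in V^# -> #[v] = 2.
  case/setD1P=> v1 vV; apply: nt_prime_order => //.
  by apply/eqP; rewrite -order_dvdn; apply: dvdn_trans (dvdn_exponent vV) V_exp2.
have imV v : v \in V -> <[v]> \subset f @* G by rewrite imf cycle_subG.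
have V_sub v : v \in V^# -> v \in V by case/setD1P.
apply/and3P; split.
- rewrite card_in_imset => [|v w vV wV /(congr1 val) /= eqvw].
    by move: V4; rewrite (cardsD1 1) group1 add1n => -[->].
  (* As [f] maps onto [V], a subgroup of [V] is recovered as the image of its preimage. *)
  have eqC : <[v]> = <[w]>.
    by rewrite -[<[v]>](morphpreK (imV _ (V_sub _ vV))) eqvw morphpreK ?imV ?V_sub.
  have : v \in <[w]> by rewrite -eqC cycle_id.
  rewrite cycle2g ?order2 // !inE.
  by case/setD1P: vV => /negbTE-> _ /eqP.
- apply/forall_inP=> _ /imsetP[v vV ->].
  rewrite properE /= subsetIl.
  apply/negP=> sGv.
  have: V \subset <[v]>.
    by rewrite -imf; apply: subset_trans (morphimS f sGv) _; rewrite morphpreK ?imV ?V_sub.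
  by move/subset_leq_card; rewrite V4 -orderE order2.
apply/eqP/setP=> g; apply/bigcupP/idP=> [[_ /imsetP[v _ ->]]|gG].
  by case/morphpreP.
have fgV : f g \in V by rewrite -imf mem_morphim.
(* The kernel of [f] lies in every preimage, so any [v] in [V^#] serves; otherwise [f g] itself is
   the index. *)
have [fg1|fg1] := eqVneq (f g) 1.
  have /card_gt0P[v vV] : 0 < #|V^#|.
    by move: V4; rewrite (cardsD1 1) group1 add1n => -[->].
  exists (f @*^-1 <[v]>)%G; first exact: imset_f.
  by rewrite mem_morphpre // fg1 group1.
exists (f @*^-1 <[f g]>)%G; first by apply: imset_f; rewrite in_setD1 fg1.
by rewrite mem_morphpre // cycle_id.
Qed.

End KleinPreimage.

(** * Dihedral groups *)

Section Dihedral.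

Import GroupScope.

Lemma is_dihedral_generators (gT : finGroupType) n (G : {group gT}) :
  is_dihedral n G ->
  exists x, exists2 y, <[x]> <*> <[y]> = G & x ^+ n = 1.
Proof.
move/isoGrp_hom/existsP=> [[x y] /=].
by case/eqP=> defG xn _ _; exists x, y.
Qed.

Lemma exponent_Z2xZ2 : exponent [set: 'Z_2 * 'Z_2] %| 2.
Proof.
apply/exponentP=> -[a b] _.
by apply/eqP; case: a b => [[|[|?]] ?] [[|[|?]] ?].
Qed.

(** By the universal property of the presentation, it is enough to find generators that satisfy the
    relations; the parity of [n] enters only in [x ^+ n = 1]. *)
Lemma Z2xZ2_homg_dihedral (gT : finGroupType) n (G : {group gT}) :
  ~~ odd n -> is_dihedral n G -> [set: 'Z_2 * 'Z_2] \homg G.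
Proof.
move=> n_even dG; rewrite dG; apply/existsP.
pose x : 'Z_2 * 'Z_2 := (Zp1, Zp0); pose y : 'Z_2 * 'Z_2 := (Zp0, Zp1).
exists (x, y); rewrite /= !xpair_eqE.
have -> : x ^+ n = 1.
  by rewrite -(even_halfK n_even) -mul2n expgM (_ : x ^+ 2 = 1) ?expg1n //; apply/eqP.
apply/and4P; split=> //.
rewrite eqEsubset subsetT /=; apply/subsetP=> -[a b] _.
(* The coordinates, read as natural numbers, serve as exponents. *)
have -> : (a, b) = x ^+ a * y ^+ b.
  by apply/eqP; case: a b => [[|[|?]] ?] [[|[|?]] ?].
by rewrite groupM // groupX // mem_gen // inE cycle_id ?orbT.
Qed.

End Dihedral.

Theorem mainTheorem8 (n : nat) (gT : finGroupType) (G : {group gT}) :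
  2 <= n -> is_dihedral n G -> num_coverings3 G = if odd n then 0 else 1.
Proof.
move=> _ dG; have [x [y defG xn]] := is_dihedral_generators dG.
have cardS (S : {set {group gT}}) : covering3 G S -> #|S| = 3.
  by case/and3P=> /eqP.
rewrite /num_coverings3; case: ifPn => [n_odd | n_even].
  apply/eqP; rewrite cards_eq0; apply/eqP/setP=> S; rewrite !inE.
  apply/negbTE/negP=> covS.
  have := leq_trans (subset_leq_card (covering3_sub_sign_kernels covS))
                    (card_sign_kernels_odd defG n_odd xn).
  by rewrite cardS.
(* A set of three elements inside a set of at most three fills it. *)
have covE S : covering3 G S -> S = sign_kernels G.
  move=> covS; apply/eqP; rewrite eqEcard covering3_sub_sign_kernels //.
  by rewrite (cardS S) // (card_sign_kernels defG).
have /homgP[f imf] := Z2xZ2_homg_dihedral n_even dG.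
have V4 : #|[set: 'Z_2 * 'Z_2]| = 4 by rewrite cardsT card_prod !card_ord.
have covS := covering3_klein_morphim imf V4 exponent_Z2xZ2.
rewrite -(cards1 (sign_kernels G)); apply: eq_card => S; rewrite !inE.
(* Conversely, [sign_kernels G] is a covering because it equals the one pulled back from the Klein
   group. *)
by apply/idP/eqP=> [/covE | ->] //; rewrite -(covE _ covS).
Qed.
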